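(* Let $P$ be a nonempty set, $X$ and $Y$ normed spaces, $F:P\times X\rightrightarrows Y$ a set-valued mapping such that $\operatorname{gph}F_p$ is convex for all $p\in P$, $\bar x\in X$, $\bar y\in Y$, $\alpha>0$, $\delta\in]0,+\infty]$ and $\mu\in]0,+\infty]$. For $p\in P$, let $\psi_p(u,v):=\|v-\bar y\|+i_{\operatorname{gph}F_p}(u,v)$, $(u,v)\in X\times Y$. If $F$ is $\alpha$-subregular in $x$ uniformly in $p$ over $P$ at $(\bar x,\bar y)$ with $\delta$ and $\mu$, then $$d_\gamma\left(0,\partial\psi_p(x,y)\right)\ge\alpha$$ with $\gamma:=\alpha^{-1}$ for all $p\in P$, $x\in B_\delta(\bar x)$ and $y\in Y$ satisfying $x\notin F_p^{-1}(\bar y)$ and $y\in F(p,x)\cap B_{\alpha\mu}(\bar y)$.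
   Context: $B_r(z)$ denotes the open ball with center $z$ and radius $r\in]0,+\infty]$. $d(z,\emptyset)=+\infty$. $i_\Omega$ is the indicator function ($0$ on $\Omega$, $+\infty$ elsewhere). For $p\in P$, $F_p:=F(p,\cdot)$, $\operatorname{gph}F_p=\{(x,y)\mid y\in F(p,x)\}$, $F_p^{-1}(y)=\{x\in X\mid y\in F(p,x)\}$. Definition. $F$ is $\alpha$-subregular in $x$ uniformly in $p$ over $P$ at $(\bar x,\bar y)$ with $\delta$ and $\mu$ if $\alpha\, d(x,F_p^{-1}(\bar y))\le d(\bar y,F(p,x))$ for all $p\in P$ and $x\in B_\delta(\bar x)$ with $d(\bar y,F(p,x))<\alpha\mu$. For $\gamma>0$, $d_\gamma$ on $X^*\times Y^*$ is the distance induced by the norm $\|(x^*,y^* )\|_\gamma=\|x^*\|+\gamma^{-1}\|y^*\|$ (dual to the norm $\max\{\|x\|,\gamma\|y\|\}$ on $X\times Y$). $\partial$ is the subdifferential of convex analysis. *)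

(* Defs.v *)
From HB Require Import structures.
From mathcomp Require Import all_boot all_order all_algebra.
From mathcomp Require Import all_classical all_reals all_analysis.

Set Implicit Arguments.
Unset Strict Implicit.
Unset Printing Implicit Defensive.

Import Order.TTheory GRing.Theory Num.Theory.
Import numFieldNormedType.Exports.

Local Open Scope classical_set_scope.
Local Open Scope ring_scope.

(* Distances d(x, A) to sets are [edist_inf A x]; this is the infimum of the
   norms `|x - a| over A, and is +oo for empty A. *)
Lemma edist_norm (R : realType) (V : normedModType R) (x y : V) :
  edist (x, y) = `|x - y|%:E.
Proof.
apply/eqP; rewrite eq_le; apply/andP; split.
  apply/lee_addgt0Pr => e e0; rewrite -EFinD; apply: edist_fin => /=.
    by rewrite ltr_wpDl.
  by rewrite -ball_normE /ball_/= ltrDl.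
rewrite /edist; apply: le_ereal_inf_tmp => _ [r [r0 +] <-] /=.
by rewrite -ball_normE /ball_/= lee_fin => /ltW.
Qed.

Lemma edist_inf_norm (R : realType) (V : normedModType R) (A : set V) (x : V) :
  edist_inf A x = ereal_inf [set `|x - a|%:E | a in A].
Proof.
rewrite /edist_inf; congr ereal_inf; apply: eq_imagel => a _.
exact: edist_norm.
Qed.

(* Open ball with a possibly infinite radius. *)
Definition eball (R : realType) (V : normedModType R) (x : V) (r : \bar R) :
    set V :=
  [set y | (`|x - y|%:E < r)%E].

Definition indicator_fun (R : realType) (T : Type) (A : set T) : T -> \bar R :=
  fun z => if z \in A then 0%E else +oo%E.
Arguments indicator_fun {R T} A z.

Section topological_dual.
Context {R : realType} (V : normedModType R).

Definition topdual_pred : {pred V -> R^o} :=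
  [pred f : V -> R^o | `[< linear f /\ continuous f >]].

Let topdual_submod : GRing.submod_closed topdual_pred.
Proof.
split=> [|a f g].
  apply/asboolP; split; last exact: cst_continuous.
  by move=> a x y; rewrite /= scaler0 addr0.
move=> /asboolP[lf cf] /asboolP[lg cg]; apply/asboolP; split.
  move=> b x y; rewrite !fctE lf lg !scalerDr !scalerA mulrC.
  by rewrite addrACA.
by move=> x; apply: continuousD (cg x); apply: continuousZl_tmp (cf x).
Qed.

HB.instance Definition _ :=
  GRing.isSubmodClosed.Build R (V -> R^o) topdual_pred topdual_submod.

(* The topological dual V^*, with the pointwise vector space structure. *)
Record topdual := TopDual {
  topdual_fun :> V -> R^o;
  topdual_funP : topdual_fun \in topdual_pred }.

HB.instance Definition _ := [isSub for topdual_fun].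
HB.instance Definition _ := [Choice of topdual by <:].
HB.instance Definition _ := [SubChoice_isSubLmodule of topdual by <:].

Lemma topdual_linear (f : topdual) : linear f.
Proof. by have /asboolP[] := topdual_funP f. Qed.

Lemma topdual_continuous (f : topdual) : continuous f.
Proof. by have /asboolP[] := topdual_funP f. Qed.

Definition topdual_norm (f : topdual) : R :=
  sup [set `|f x| | x in [set x : V | `|x| <= 1]].

(* The subdifferential of convex analysis; empty where f is not finite. *)
Definition subdifferential (f : V -> \bar R) (z : V) : set topdual :=
  [set zs | f z \is a fin_num /\
            forall w : V, (f z + (zs (w - z))%:E <= f w)%E].

End topological_dual.

Section dual_of_product.
Context {R : realType} (X Y : normedModType R).

(* The identification of X^* * Y^* with the dual of X * Y. *)
Definition pair_functional (zs : topdual X * topdual Y) : (X * Y)%type -> R^o :=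
  fun w => zs.1 w.1 + zs.2 w.2.

Lemma pair_functional_topdual (zs : topdual X * topdual Y) :
  pair_functional zs \in @topdual_pred R (X * Y)%type.
Proof.
apply/asboolP; split=> [a u v|w].
  rewrite /pair_functional /= !topdual_linear scalerDr.
  exact: addrACA.
apply: (@cvgD _ R^o _ _ _ (fun u : X * Y => zs.1 u.1)
  (fun u : X * Y => zs.2 u.2)).
- apply: (@continuous_comp _ _ _ fst zs.1); last exact: topdual_continuous.
  exact: (@cvg_fst _ _ (nbhs w.1) (nbhs w.2)).
- apply: (@continuous_comp _ _ _ snd zs.2); last exact: topdual_continuous.
  exact: (@cvg_snd _ _ (nbhs w.1) (nbhs w.2)).
Qed.

Definition pair_topdual (zs : topdual X * topdual Y) : topdual (X * Y)%type :=
  TopDual (pair_functional_topdual zs).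

Definition subdifferential2 (f : X * Y -> \bar R) (z : X * Y) :
    set (topdual X * topdual Y) :=
  pair_topdual @^-1` subdifferential (f : (X * Y)%type -> \bar R) z.

Definition norm_gamma (gamma : R) (zs : topdual X * topdual Y) : R :=
  topdual_norm zs.1 + gamma^-1 * topdual_norm zs.2.

Definition dist_gamma (gamma : R) (zs : topdual X * topdual Y)
    (A : set (topdual X * topdual Y)) : \bar R :=
  ereal_inf [set (norm_gamma gamma (zs - ws))%:E | ws in A].

End dual_of_product.

Section set_valued_mappings.
Context {R : realType} {P : Type} {X Y : normedModType R}.
Implicit Type F : P -> X -> set Y.

Definition gph (G : X -> set Y) : set (X * Y) := [set z | G z.1 z.2].

Definition preimage_at (G : X -> set Y) (y : Y) : set X := [set x | G x y].

Definition unif_subregular (alpha : R) F (xbar : X) (ybar : Y)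
    (delta mu : \bar R) : Prop :=
  forall (p : P) (x : X), eball xbar delta x ->
    (edist_inf (F p x) ybar < alpha%:E * mu)%E ->
    (alpha%:E * edist_inf (preimage_at (F p) ybar) x
       <= edist_inf (F p x) ybar)%E.

Definition psi F (ybar : Y) (p : P) (z : X * Y) : \bar R :=
  (`|z.2 - ybar|%:E + indicator_fun (gph (F p)) z)%E.

End set_valued_mappings.

(* Main.v *)
(* If (x*, y* ) is a subgradient of psi_p at (x, y), then evaluating the
   subgradient inequality at the points (u, ybar) of gph F_p gives
   |y - ybar| <= ||x*|| |u - x| + ||y*|| |y - ybar|.  Subregularity bounds the
   infimum of |u - x| over u in F_p^-1(ybar) by alpha^-1 |y - ybar|, and
   dividing by |y - ybar| > 0 gives alpha <= ||x*|| + alpha ||y*||. *)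
Require Import Defs.
From HB Require Import structures.
From mathcomp Require Import all_boot all_order all_algebra.
From mathcomp Require Import all_classical all_reals all_analysis.
From mathcomp Require Import ring.

Set Implicit Arguments.
Unset Strict Implicit.
Unset Printing Implicit Defensive.

Import Order.TTheory GRing.Theory Num.Theory.
Import numFieldNormedType.Exports.

Local Open Scope classical_set_scope.
Local Open Scope ring_scope.

HB.instance Definition _ (R : realType) (V : normedModType R)
    (f : topdual V) :=
  GRing.isLinear.Build R V R^o *:%R (topdual_fun f) (topdual_linear f).

(** A continuous linear map satisfies [|f x| <= M * |x|] for some [M], hence is bounded by [M] on
    the unit ball. This makes the [sup] in [topdual_norm] a genuine least upper bound. *)
Lemma topdual_has_ubound (R : realType) (V : normedModType R)
    (f : topdual V) :
  has_ubound [set `|f x| | x in [set x : V | `|x| <= 1]].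
Proof.
have /linear_boundedP/pinfty_ex_gt0[M M0 fM] : bounded_near f (nbhs (0 : V)).
  by apply: continuous_linear_bounded; exact: topdual_continuous.
exists M => _ [x /= x1 <-]; apply: (le_trans (fM x)).
by rewrite ger_pMr.
Qed.

Lemma topdual_norm_ge0 (R : realType) (V : normedModType R) (f : topdual V) :
  0 <= topdual_norm f.
Proof.
have : 0 <= `|f 0| by [].
move/le_trans; apply; apply: (ub_le_sup (topdual_has_ubound f)).
by exists 0 => //=; rewrite normr0.
Qed.

(** For nonzero [x], the normalized vector [x / |x|] is a competitor in the supremum. *)
Lemma le_topdual_norm (R : realType) (V : normedModType R) (f : topdual V)
    (x : V) :
  `|f x| <= topdual_norm f * `|x|.
Proof.
have [->|x0] := eqVneq x 0.
  by rewrite normr0 mulr0 linear0 normr0.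
have nx0 : 0 < `|x| by rewrite normr_gt0.
rewrite -ler_pdivrMr//; apply: (ub_le_sup (topdual_has_ubound f)).
exists (`|x|^-1 *: x) => /=.
  by rewrite normrZ normfV normr_id mulVf// gt_eqF.
by rewrite linearZ normrZ normfV normr_id mulrC.
Qed.

Lemma topdual_normN (R : realType) (V : normedModType R) (f : topdual V) :
  topdual_norm (- f) = topdual_norm f.
Proof.
by congr sup; apply: eq_imagel => x _; rewrite -[LHS]normrN opprK.
Qed.

Lemma subgradient_psi (R : realType) (P : Type) (X Y : normedModType R)
    (F : P -> X -> set Y) (ybar : Y) (p : P) (x u : X) (y : Y)
    (zs : topdual X * topdual Y) :
  F p x y -> F p u ybar -> subdifferential2 (psi F ybar p) (x, y) zs ->
  `|y - ybar| <= topdual_norm zs.1 * `|u - x| + topdual_norm zs.2 * `|y - ybar|.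
Proof.
move=> Fxy Fuy [_ /(_ (u, ybar))].
rewrite /psi /indicator_fun !mem_set//= subrr normr0 !adde0 -EFinD lee_fin.
rewrite /pair_functional /= => h; rewrite -subr_ge0.
(* The middle term is nonnegative by [h]; each functional is then bounded by its dual norm. *)
apply: (le_trans
  (y := - (zs.1 (u - x) + zs.2 (ybar - y)) - `|y - ybar|)).
  by rewrite -opprD oppr_ge0 addrC.
rewrite lerD2r opprD lerD//.
  by rewrite (le_trans (ler_norm _))// normrN le_topdual_norm.
by rewrite (le_trans (ler_norm _))// normrN distrC le_topdual_norm.
Qed.

Theorem proposition4p12 (R : realType) (P : Type) (X Y : normedModType R)
    (F : P -> X -> set Y) (xbar : X) (ybar : Y) (alpha : R)
    (delta mu : \bar R)
    (P_nonempty : [set: P] !=set0)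
    (gph_convex : forall p : P,
       convex_set (gph (F p) : set (convex_lmodType (X * Y)%type)))
    (alpha_gt0 : 0 < alpha)
    (delta_gt0 : (0 < delta)%E)
    (mu_gt0 : (0 < mu)%E)
    (F_subregular : unif_subregular alpha F xbar ybar delta mu) :
  forall (p : P) (x : X) (y : Y),
    eball xbar delta x ->
    ~ preimage_at (F p) ybar x ->
    (F p x `&` eball ybar (alpha%:E * mu)%E) y ->
    (alpha%:E <=
       dist_gamma alpha^-1 0%R (subdifferential2 (psi F ybar p) (x, y)))%E.
Proof.
move=> p x y xdelta xNF [Fxy].
rewrite /eball /= distrC; set t := `|y - ybar| => tmu.
have t0 : 0 < t.
  rewrite normr_gt0 subr_eq0; apply/eqP => yE.
  by apply: xNF; rewrite /preimage_at /= -yE.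
(* Since [y] lies in [F p x], this distance is at most [t], hence below [alpha * mu], so
   subregularity applies at [x]. *)
have dFt : (edist_inf (F p x) ybar <= t%:E)%E.
  rewrite edist_inf_norm; apply: ereal_inf_lbound.
  by exists y; rewrite // distrC.
have dt : (edist_inf (preimage_at (F p) ybar) x <= (t / alpha)%:E)%E.
  rewrite -(@lee_pmul2l _ alpha%:E)// -EFinM mulrCA divff ?gt_eqF// mulr1.
  apply: (le_trans _ dFt); apply: F_subregular => //.
  exact: (le_lt_trans dFt tmu).
apply: le_ereal_inf_tmp => _ [[xs ys] sub_zs <-].
rewrite lee_fin /norm_gamma /= !sub0r !topdual_normN invrK.
set a := topdual_norm xs; set b := topdual_norm ys.
have a0 : 0 <= a := topdual_norm_ge0 xs.
(* The distance from [x] to the preimage need not be attained, so a slack [e] is allowed. *)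
apply/ler_addgt0Pr => e e0.
(* Chosen so that [alpha * a * eta <= e * t]; the denominator has [a + 1] because [a] may vanish. *)
pose eta := e * t / (alpha * (a + 1)).
have eta0 : 0 < eta by rewrite divr_gt0 ?mulr_gt0// ltr_wpDl.
(* A finite strict bound on the infimum also shows that the preimage is nonempty and supplies
   [u]. *)
have : (edist_inf (preimage_at (F p) ybar) x < (t / alpha + eta)%:E)%E.
  by rewrite (le_lt_trans dt)// lte_fin ltrDl.
rewrite edist_inf_norm => /ereal_inf_lt[_ [u Fu <-]]; rewrite lte_fin => ult.
have := @subgradient_psi _ _ _ _ F ybar p x u y (xs, ys) Fxy Fu sub_zs.
rewrite -/t -/a -/b distrC => tab.
(* Multiplied by [t], the goal reads [alpha * t <= (a + alpha * b + e) * t]. *)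
rewrite -(ler_pM2r t0).
have aeta : alpha * (a * eta) <= e * t.
  have -> : alpha * (a * eta) = e * t * (a / (a + 1)).
    by rewrite /eta; field; rewrite !gt_eqF ?ltr_wpDl.
  by rewrite ger_pMr ?mulr_gt0// ler_pdivrMr ?ltr_wpDl// mul1r lerDl.
have : alpha * t <= alpha * (a * (t / alpha + eta) + b * t).
  by rewrite ler_pM2l// (le_trans tab)// lerD2r ler_wpM2l// ltW.
have -> : alpha * (a * (t / alpha + eta) + b * t) =
    (a + alpha * b) * t + alpha * (a * eta).
  by field; rewrite gt_eqF.
move/le_trans; apply.
by rewrite [X in _ <= X]mulrDl lerD2l.
Qed.
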